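(* Let $H_n$ be the pyrene system with $n$ pyrene fragments, and let $Af(H_0,x)=1$. Then $Af(H_1,x)=2x^3+2x^2+2x$ and for all $n\ge2$, $$Af(H_n,x)=(2x^3+2x^2+2x)Af(H_{n-1},x)-x^2Af(H_{n-2},x).$$
   Context: Pyrene system: draw the hexagonal lattice so that every hexagon has two vertical sides; horizontally adjacent hexagons then share a vertical edge. For $n\ge1$, $H_n$ is the hexagonal system (the plane graph formed by the vertices and edges of the following $4n$ hexagons) consisting of a horizontal linear row of $2n$ hexagons $h_{1,1},h_{1,2},\dots,h_{n,1},h_{n,2}$, consecutive ones sharing a vertical edge, together with, for each $i$, a hexagon $s_{i,1}$ directly above and a hexagon $s_{i,2}$ directly below the common edge of $h_{i,1}$ and $h_{i,2}$ (each sharing an edge with both $h_{i,1}$ and $h_{i,2}$). $H_0$ is the null graph. For a perfect matching $M$ of $G$, an anti-forcing set of $M$ is a set $S\subseteq E(G)\setminus M$ such that $M$ is the unique perfect matching of $G-S$; the anti-forcing number $af(G,M)$ is the minimum size of an anti-forcing set of $M$. The anti-forcing polynomial is $Af(G,x)=\sum_{M\in\mathcal{M}(G)}x^{af(G,M)}$, where $\mathcal{M}(G)$ is the set of perfect matchings of $G$. *)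

(* Defs.v *)
From HB Require Import structures.
From mathcomp Require Import all_boot all_order all_algebra.
Set Implicit Arguments. Unset Strict Implicit. Unset Printing Implicit Defensive.
Import GRing.Theory.

(* The hexagonal lattice is represented in its "brick wall" form: vertices    *)
(* are integer points (x,y); a hexagon ("brick") with lower-left corner (x,y) *)
(* (x+y even) has the six vertices (x,y),(x+1,y),(x+2,y),(x+2,y+1),(x+1,y+1), *)
(* (x,y+1), four horizontal edges and two vertical edges {(x,y),(x,y+1)} and  *)
(* {(x+2,y),(x+2,y+1)}.  This is graph-isomorphic to the hexagonal lattice    *)
(* drawn with two vertical sides per hexagon; horizontally adjacent hexagons  *)
(* (x,y),(x+2,y) share a vertical edge, and (x+1,y+1) / (x+1,y-1) are the     *)
(* hexagons directly above / below their common edge.                         *)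

(* hexagons of H_n, as lower-left corners:
   h_{i,1} = (4i+1,1), h_{i,2} = (4i+3,1), s_{i,1} = (4i+2,2), s_{i,2} = (4i+2,0),
   for i = 0..n-1 *)
Definition hexes (n : nat) : seq (nat * nat) :=
  flatten [seq [:: (4 * i + 1, 1); (4 * i + 3, 1); (4 * i + 2, 2); (4 * i + 2, 0)]
          | i <- iota 0 n].

Definition hex_vertex (h : nat * nat) (p : nat * nat) : bool :=
  let: (x, y) := h in
  (p \in [:: (x, y); (x.+1, y); (x.+2, y); (x, y.+1); (x.+1, y.+1); (x.+2, y.+1)]).

(* edges as ordered pairs (smaller endpoint first) *)
Definition hex_edge (h : nat * nat) (p q : nat * nat) : bool :=
  let: (x, y) := h in
  ((p, q) \in [:: ((x, y), (x.+1, y)); ((x.+1, y), (x.+2, y));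
                  ((x, y.+1), (x.+1, y.+1)); ((x.+1, y.+1), (x.+2, y.+1));
                  ((x, y), (x, y.+1)); ((x.+2, y), (x.+2, y.+1))]).

(* ambient finite vertex / edge types (large enough to contain H_n) *)
Definition V (n : nat) : finType := ('I_(4 * n + 4) * 'I_4)%type.
Definition E (n : nat) : finType := (V n * V n)%type.

Definition coord n (v : V n) : nat * nat := (nat_of_ord v.1, nat_of_ord v.2).

Definition VH (n : nat) : {set V n} :=
  [set v : V n | has (fun h => hex_vertex h (coord v)) (hexes n)].
Definition EH (n : nat) : {set E n} :=
  [set e : E n | has (fun h => hex_edge h (coord e.1) (coord e.2)) (hexes n)].

Definition is_pm (T : finType) (VS : {set T}) (ES M : {set T * T}) : bool :=
  (M \subset ES) &&
  [forall v in VS, #|[set e in M | (e.1 == v) || (e.2 == v)]| == 1].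

Definition anti_forcing (T : finType) (VS : {set T}) (ES M S : {set T * T}) : bool :=
  (S \subset ES :\: M) &&
  [forall M' : {set T * T}, is_pm VS (ES :\: S) M' ==> (M' == M)].

Definition af (T : finType) (VS : {set T}) (ES M : {set T * T}) : nat :=
  \big[minn/#|{: (T * T)%type}|]_(S : {set T * T} | anti_forcing VS ES M S) #|S|.

Definition Af (T : finType) (VS : {set T}) (ES : {set T * T}) : {poly int} :=
  (\sum_(M : {set T * T} | is_pm VS ES M) 'X^(af VS ES M))%R.

Definition AfH (n : nat) : {poly int} :=
  if n is 0 then 1%R else Af (VH n) (EH n).

(* Main.v *)
From mathcomp Require Import all_boot all_order all_algebra.
From mathcomp Require Import zify ring.
Require Import Defs.
Set Implicit Arguments. Unset Strict Implicit. Unset Printing Implicit Defensive.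
Import GRing.Theory.

(* Cut [H_n] along the vertical edges between consecutive fragments.  In each
   fragment a perfect matching is in one of six states: A or B when the central
   vertical edge is matched and the fragment then covers both ends of its left,
   resp. right, boundary edge, and four states N otherwise (two choices in the
   upper hexagon times two in the lower one).  Perfect matchings are the words
   in these letters without a factor BA.  The anti-forcing number is additive:
   A and B cost 1, N costs 3 or 2 according to whether its two choices agree.

   For the upper bound, blocking in each fragment as many edges as the letter
   costs determines the word.  For the lower bound, an anti-forcing set of M
   meets M' \ M for every other perfect matching M', and one finds as many M' as
   the total cost with pairwise disjoint M' \ M.  They come from changing a
   single letter, except for the third one attached to an N with agreeing
   choices, which turns a factor N A^k into B^(k+1), or B^k N into A^(k+1).

   The recurrence then counts words without factor BA. *)

(** * The graph in grid coordinates *)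

(* [d = true] stands for the vertical edge going up from [(x, y)]. *)
Definition key (d : bool) (x y : nat) : (nat * nat) * (nat * nat) :=
  ((x, y), if d then (x, y.+1) else (x.+1, y)).

Definition edge_at (n : nat) (d : bool) (x y : nat) : bool :=
  if d then (y == 1) && odd x && (x <= 4 * n + 1)
            || ((y == 0) || (y == 2)) && ~~ odd x && (0 < x <= 4 * n)
  else ((y == 1) || (y == 2)) && (0 < x <= 4 * n)
       || ((y == 0) || (y == 3)) && ((x %% 4 == 2) || (x %% 4 == 3)) && (x < 4 * n).

Definition vertex_at (n x y : nat) : bool :=
  ((y == 1) || (y == 2)) && (0 < x <= 4 * n + 1)
  || ((y == 0) || (y == 3)) && (x %% 4 != 1) && (0 < x <= 4 * n).

Lemma key_eq d x y d' x' y' :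
  (key d x y == key d' x' y') = [&& d == d', x == x' & y == y'].
Proof.
rewrite /key !xpair_eqE; case: (eqVneq x x') => [->|]; last by rewrite andbF.
case: (eqVneq y y') => [->|]; last by rewrite !andbF.
by case: d; case: d'; rewrite !xpair_eqE //=; lia.
Qed.

Definition ecoord n (e : E n) := (coord e.1, coord e.2).

Lemma coord_inj n : injective (@coord n).
Proof. by move=> [a b] [c d] [/val_inj -> /val_inj ->]. Qed.

Lemma ecoord_inj n : injective (@ecoord n).
Proof. by move=> [a b] [c d] [] *; congr pair; apply: coord_inj; congr pair. Qed.

Lemma hexesP n h : reflect (exists2 i, i < n &
    h \in [:: (4 * i + 1, 1); (4 * i + 3, 1); (4 * i + 2, 2); (4 * i + 2, 0)])
  (h \in hexes n).
Proof.
apply: (iffP flatten_mapP) => [[i]|[i lt_in hh]].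
  by rewrite mem_iota => lt_in hh; exists i.
by exists i; rewrite // mem_iota.
Qed.

Lemma mem_EH n (e : E n) : 0 < n ->
  reflect (exists d x y, ecoord e = key d x y /\ edge_at n d x y) (e \in EH n).
Proof.
move=> n_gt0; rewrite inE; apply: (iffP hasP) => [[h /hexesP[i lt_in hh]]|].
  rewrite !inE in hh; rewrite /ecoord /hex_edge; case: h hh => hx hy hh.
  move: (coord e.1) (coord e.2) => p q.
  rewrite !inE => Hpq.
  have {Hpq}[d [x [y [-> -> Exy]]]] : exists d x y,
      [/\ p = (key d x y).1, q = (key d x y).2
      & if d then (y == hy) && ((x == hx) || (x == hx.+2))
        else ((x == hx) || (x == hx.+1)) && ((y == hy) || (y == hy.+1))].
    case/or4P: Hpq => [| | |/or3P[]] /eqP[-> ->].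
    - by exists false, hx, hy; rewrite !eqxx.
    - by exists false, hx.+1, hy; rewrite !eqxx orbT.
    - by exists false, hx, hy.+1; rewrite !eqxx orbT.
    - by exists false, hx.+1, hy.+1; rewrite !eqxx !orbT.
    - by exists true, hx, hy; rewrite !eqxx.
    - by exists true, hx.+2, hy; rewrite !eqxx orbT.
  exists d, x, y; split=> //; rewrite !xpair_eqE in hh.
  by case/or4P: hh => /andP[/eqP hxE /eqP hyE]; subst hx hy;
    move: Exy; rewrite /edge_at; case: d; lia.
move=> [d [x [y [Ee Exy]]]].
have [-> ->] : coord e.1 = (key d x y).1 /\ coord e.2 = (key d x y).2.
  by rewrite -Ee.
have [i [r [Dx r_lt4]]] : exists i r, x = 4 * i + r.+1 /\ r < 4.
  exists (x.-1 %/ 4), (x.-1 %% 4); move: Exy; rewrite /edge_at; case: d {Ee}; lia.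
have hexI j h : j < n ->
  h \in [:: (4 * j + 1, 1); (4 * j + 3, 1); (4 * j + 2, 2); (4 * j + 2, 0)] ->
  hex_edge h (key d x y).1 (key d x y).2 ->
  exists2 h, h \in hexes n & hex_edge h (key d x y).1 (key d x y).2.
  by move=> lt_jn hj; exists h => //; apply/hexesP; exists j.
have [|le_ni] := ltnP i n; last first.
  apply: (hexI n.-1 (4 * n.-1 + 3, 1)); first lia.
    by rewrite !inE eqxx orbT.
  have [-> -> ->] : [/\ d = true, x = (4 * n.-1 + 3).+2 & y = 1].
    by move: Exy; rewrite /edge_at; case: (d); split; lia.
  by rewrite /hex_edge /key !inE eqxx !orbT.
move=> lt_in; subst x.
have {}Exy : exists2 h,
    h \in [:: (4 * i + 1, 1); (4 * i + 3, 1); (4 * i + 2, 2); (4 * i + 2, 0)]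
    & hex_edge h (key d (4 * i + r.+1) y).1 (key d (4 * i + r.+1) y).2.
  have [y1|y_neq1] := boolP (if d then y == 1 else (y == 1) || (y == 2)).
    exists (if r < 2 then (4 * i + 1, 1) else (4 * i + 3, 1)).
      by case: ifP; rewrite !inE eqxx ?orbT.
    move: Exy y1; rewrite /edge_at /key /hex_edge.
    by case: r r_lt4 {Ee hexI} => [|[|[|[|]]]] //= _; case: d => /=;
      case: y => [|[|[|[|]]]] //=; rewrite !inE !xpair_eqE /=; lia.
  exists (if y < 2 then (4 * i + 2, 0) else (4 * i + 2, 2)).
    by case: ifP; rewrite !inE eqxx ?orbT.
  move: Exy y_neq1; rewrite /edge_at /key /hex_edge.
  by case: r r_lt4 {Ee hexI} => [|[|[|[|]]]] //= _; case: d => /=;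
    case: y => [|[|[|[|]]]] //=; rewrite !inE !xpair_eqE /=; lia.
by case: Exy => h hh Eh; apply: hexI lt_in hh Eh.
Qed.

Lemma mem_VH n (v : V n) : 0 < n ->
  (v \in VH n) = vertex_at n (coord v).1 (coord v).2.
Proof.
move=> n_gt0; rewrite inE; case: (coord v) => x y /=.
apply/hasP/idP => [[[hx hy] /hexesP[i lt_in hh]]|Vxy].
  rewrite /hex_vertex !inE !xpair_eqE /vertex_at in hh *.
  by case/or4P: hh => /andP[/eqP-> /eqP->]; lia.
have hexI j h : j < n ->
  h \in [:: (4 * j + 1, 1); (4 * j + 3, 1); (4 * j + 2, 2); (4 * j + 2, 0)] ->
  hex_vertex h (x, y) -> exists2 h, h \in hexes n & hex_vertex h (x, y).
  by move=> lt_jn hj; exists h => //; apply/hexesP; exists j.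
have [y1|y_neq1] := boolP ((y == 1) || (y == 2)).
  have [x_lt|x_ge] := ltnP x (4 * n + 1).
    apply: (hexI (x.-1 %/ 4)
      (if x.-1 %% 4 < 2 then (4 * (x.-1 %/ 4) + 1, 1) else (4 * (x.-1 %/ 4) + 3, 1))).
    - by move: Vxy; rewrite /vertex_at; lia.
    - by case: ifP; rewrite !inE eqxx ?orbT.
    - by move: Vxy; rewrite /vertex_at; case: ifP;
        rewrite /hex_vertex !inE !xpair_eqE; lia.
  apply: (hexI n.-1 (4 * n.-1 + 3, 1)); first lia.
    by rewrite !inE eqxx orbT.
  by move: Vxy; rewrite /vertex_at /hex_vertex !inE !xpair_eqE; lia.
apply: (hexI (x.-1 %/ 4)
  (if y < 2 then (4 * (x.-1 %/ 4) + 2, 0) else (4 * (x.-1 %/ 4) + 2, 2))).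
- by move: Vxy; rewrite /vertex_at; lia.
- by case: ifP; rewrite !inE eqxx ?orbT.
- by move: Vxy; rewrite /vertex_at; case: ifP;
    rewrite /hex_vertex !inE !xpair_eqE; lia.
Qed.

Definition has_edge n (M : {set E n}) (d : bool) (x y : nat) : bool :=
  [exists e in M, ecoord e == key d x y].

Lemma has_edgeP n (M : {set E n}) d x y (e : E n) :
  ecoord e = key d x y -> has_edge M d x y = (e \in M).
Proof.
move=> Ee; apply/exists_inP/idP => [[f fM /eqP]|eM].
  by rewrite -Ee => /ecoord_inj <-.
by exists e => //; apply/eqP.
Qed.

Lemma has_edge_sub n (M : {set E n}) d x y :
  0 < n -> M \subset EH n -> has_edge M d x y -> edge_at n d x y.
Proof.
move=> n_gt0 /subsetP sME /exists_inP[e /sME/(mem_EH _ n_gt0)].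
by case=> d' [x' [y' [-> E']]]; rewrite key_eq => /and3P[/eqP<- /eqP<- /eqP<-].
Qed.

Lemma sum_key n (M : {set E n}) d x y :
  \sum_(e in M) (ecoord e == key d x y) = has_edge M d x y.
Proof.
rewrite /has_edge; case: exists_inP => [[e eM /eqP De]|no_e].
  rewrite (bigD1 e) //= De eqxx big1 ?addn0 // => f /andP[_ neq_fe].
  by rewrite -De (inj_eq (@ecoord_inj n)) (negPf neq_fe).
by rewrite big1 // => e eM; case: eqP => // De; case: no_e; exists e => //; apply/eqP.
Qed.

Definition grid_degree (m : bool -> nat -> nat -> bool) (x y : nat) : nat :=
  m false x y + m true x y + ((0 < x) && m false x.-1 y) + ((0 < y) && m true x y.-1).

Lemma degree_grid n (M : {set E n}) (v : V n) x y :
  0 < n -> M \subset EH n -> coord v = (x, y) ->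
  #|[set e in M | (e.1 == v) || (e.2 == v)]| =
  grid_degree (has_edge M) x y.
Proof.
rewrite /grid_degree.
move=> n_gt0 /subsetP sME Dv; rewrite -sum1_card.
rewrite (eq_bigl (fun e => (e \in M) && ((e.1 == v) || (e.2 == v))));
  last by move=> e; rewrite inE.
rewrite big_mkcondr /=.
have pred_eq (z c : nat) (b : bool) :
  (0 < z) && (b && (c == z.-1)) = b && (c.+1 == z) by case: z b => [|z] [].
have mulE (b c : bool) : (b && c : nat) = b * c by case: b; rewrite // mul1n.
rewrite (mulE (0 < x)) (mulE (0 < y)) -!sum_key !big_distrr -!big_split /=.
apply: eq_bigr => e /sME/(mem_EH _ n_gt0)[d [a [b [De _]]]].
rewrite -!mulE De !key_eq -!(inj_eq (@coord_inj n)) Dv.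
have [-> ->] : coord e.1 = (key d a b).1 /\ coord e.2 = (key d a b).2.
  by rewrite -De.
rewrite /key; case: d {De}; rewrite !xpair_eqE /= ?andbF ?addn0 ?add0n.
  by rewrite pred_eq; case: (a == x) => //=; case: eqP => [->|] //=; case: eqP; lia.
have ->  : (0 < x) && ((a == x.-1) && (b == y)) = (a.+1 == x) && (b == y).
  by rewrite ![_ && (b == y)]andbC pred_eq.
by case: (b == y); rewrite ?andbF // !andbT; case: eqP => [->|] //=; case: eqP; lia.
Qed.

Lemma coord_surj n x y : x < 4 * n + 4 -> y < 4 -> exists v : V n, coord v = (x, y).
Proof. by move=> lt_x lt_y; exists (Ordinal lt_x, Ordinal lt_y). Qed.

Lemma ecoord_surj n d x y : edge_at n d x y -> exists e : E n, ecoord e = key d x y.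
Proof.
move=> Exy.
have [|| v Dv] := @coord_surj n x y; [by move: Exy; rewrite /edge_at; case: d; lia..|].
have [|| w Dw] := @coord_surj n (key d x y).2.1 (key d x y).2.2.
- by move: Exy; rewrite /edge_at; case: d => /=; lia.
- by move: Exy; rewrite /edge_at; case: d => /=; lia.
by exists (v, w); rewrite /ecoord /= Dv Dw /key; case: (d).
Qed.

Lemma is_pmP n (M : {set E n}) : 0 < n ->
  reflect (M \subset EH n /\
           forall x y, vertex_at n x y -> grid_degree (has_edge M) x y = 1)
          (is_pm (VH n) (EH n) M).
Proof.
move=> n_gt0; apply: (iffP andP) => -[sME degM]; split=> //.
  move=> x y Vxy.
  have [|| v Dv] := @coord_surj n x y; [by move: Vxy; rewrite /vertex_at; lia..|].
  rewrite -(degree_grid n_gt0 sME Dv); apply/eqP.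
  by apply: (forall_inP degM); rewrite mem_VH // Dv.
apply/forall_inP => v; rewrite mem_VH // => Vv.
by rewrite (degree_grid (x := (coord v).1) (y := (coord v).2) n_gt0 sME) // degM.
Qed.

Lemma has_edge_inj n (M N : {set E n}) : 0 < n -> M \subset EH n -> N \subset EH n ->
  (forall d x y, edge_at n d x y -> has_edge M d x y = has_edge N d x y) -> M = N.
Proof.
move=> n_gt0 sM sN eqMN; apply/setP => e.
have [/(mem_EH _ n_gt0)[d [x [y [De /eqMN]]]]|notE] := boolP (e \in EH n).
  by rewrite !(has_edgeP _ De).
by rewrite (contraNF (subsetP sM e) notE) (contraNF (subsetP sN e) notE).
Qed.

(** * Matchings as words *)

(* A letter records whether the central vertical edge of a fragment is matched,
   and whether the left vertical edge of its lower, resp. upper, hexagon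
   [s_{i,2}], [s_{i,1}] is: this determines the matching on the fragment. *)
Definition letter : finType := (bool * bool * bool)%type.
Definition mid (l : letter) := l.1.1.
(* Rows 0 and 1 belong to the lower half, rows 2 and 3 to the upper half. *)
Definition leg (l : letter) (y : nat) := if y < 2 then l.1.2 else l.2.
Definition good (l : letter) := mid l ==> (l.1.2 == l.2).
Definition isA (l : letter) := mid l && ~~ l.2.
Definition isB (l : letter) := mid l && l.2.

(* The boundary edge at abscissa [4 * i + 1] is matched. *)
Definition column (u : nat -> letter) (i : nat) :=
  ~~ isA (u i) && ~~ ((0 < i) && isB (u i.-1)).

(* Edge whose lower-left end has abscissa [4 * i + r + 1], the boundary edge
   ([d = true], [r = 0]) excepted. *)
Definition letter_edge (l : letter) (d : bool) (r y : nat) : bool :=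
  let row := (y == 1) || (y == 2) in
  match r with
  | 0 => ~~ d && (mid l && ~~ leg l y)
  | 1 => if d then leg l y else ~~ leg l y && ~~ (row && mid l)
  | 2 => if d then mid l else leg l y && ~~ (row && mid l)
  | _ => if d then ~~ leg l y else mid l && leg l y
  end.

Definition word_edge (u : nat -> letter) (d : bool) (x y : nat) : bool :=
  if d && (x.-1 %% 4 == 0) then column u (x.-1 %/ 4)
  else letter_edge (u (x.-1 %/ 4)) d (x.-1 %% 4) y.

Lemma word_edge_block u d i r y : r < 4 ->
  word_edge u d (4 * i + r).+1 y =
  if d && (r == 0) then column u i else letter_edge (u i) d r y.
Proof.
move=> r_lt4; rewrite /word_edge.
by have [-> ->] : (4 * i + r) %/ 4 = i /\ (4 * i + r) %% 4 = r by lia.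
Qed.

Arguments word_edge : simpl never.
Arguments edge_at : simpl never.

Record valid_word (n : nat) (u : nat -> letter) : Prop := ValidWord {
  valid_good : forall i, good (u i);
  valid_next : forall i, isB (u i) -> ~~ isA (u i.+1);
  valid_end : forall i, n <= i -> ~~ mid (u i) }.

Section WordEdge.
Variables (u : nat -> letter) (d : bool) (i y : nat).
Let row := (y == 1) || (y == 2).
Let s := leg (u i) y.
Let c := mid (u i).

Lemma word_edge1 :
  word_edge u d (4 * i).+1 y = if d then column u i else c && ~~ s.
Proof. by rewrite -[4 * i]addn0 word_edge_block //; case: (d). Qed.

Lemma word_edge2 :
  word_edge u d (4 * i).+2 y = if d then s else ~~ s && ~~ (row && c).
Proof. by rewrite -[(4 * i).+1]addn1 word_edge_block // andbF. Qed.

Lemma word_edge3 :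
  word_edge u d (4 * i).+3 y = if d then c else s && ~~ (row && c).
Proof. by rewrite -[(4 * i).+2]addn2 word_edge_block // andbF. Qed.

Lemma word_edge4 :
  word_edge u d (4 * i).+4 y = if d then ~~ s else c && s.
Proof. by rewrite -[(4 * i).+3]addn3 word_edge_block // andbF. Qed.
End WordEdge.

Definition word_edgeE := (word_edge1, word_edge2, word_edge3, word_edge4).

Section EdgeAt.
Variables (n i : nat).
Hypothesis lt_in : i < n.

Lemma edge_at1 d y :
  edge_at n d (4 * i).+1 y = if d then y == 1 else (y == 1) || (y == 2).
Proof. by rewrite /edge_at; case: d; lia. Qed.

Lemma edge_at2 d y :
  edge_at n d (4 * i).+2 y = if d then (y == 0) || (y == 2) else y < 4.
Proof. by rewrite /edge_at; case: d; lia. Qed.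

Lemma edge_at3 d y : edge_at n d (4 * i).+3 y = if d then y == 1 else y < 4.
Proof. by rewrite /edge_at; case: d; lia. Qed.

Lemma edge_at4 d y :
  edge_at n d (4 * i).+4 y = (if d then y == 0 else y == 1) || (y == 2).
Proof. by rewrite /edge_at; case: d; lia. Qed.
End EdgeAt.

Definition edge_atE := (edge_at1, edge_at2, edge_at3, edge_at4).

Lemma block_split x : 0 < x -> exists i r, x = (4 * i + r).+1 /\ r < 4.
Proof. by exists (x.-1 %/ 4), (x.-1 %% 4); lia. Qed.

Lemma half_block (tL tR lL lR iL iR oL oR c : bool) :
  tL + tR = 1 -> tL + lL = 1 -> tR + lR = 1 ->
  oL + lL + iL = 1 -> iL + iR + c = 1 -> iR + lR + oR = 1 ->
  [/\ tL = ~~ lL, tR = lL, lR = ~~ lL & [/\ iL = ~~ lL && ~~ c, iR = lL && ~~ c,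
      oL = c && ~~ lL & oR = c && lL]].
Proof.
by case: tL; case: tR; case: lL; case: lR; case: iL; case: iR; case: oL; case: oR; case: c.
Qed.

Section Classification.
Variables (n : nat) (m : bool -> nat -> nat -> bool).
Hypothesis m_edge : forall d x y, m d x y -> edge_at n d x y.
Hypothesis m_degree : forall x y, vertex_at n x y -> grid_degree m x y = 1.

Definition word_of (i : nat) : letter :=
  (m true (4 * i).+3 1, m true (4 * i).+2 0, m true (4 * i).+2 2).

Local Lemma m_out d x y : ~~ edge_at n d x y -> m d x y = false.
Proof. by apply: contraNF => /m_edge. Qed.

Local Ltac degree_at x y :=
  have : grid_degree m x y = 1; first by apply: m_degree; rewrite /vertex_at; lia.
Local Ltac drop_nonedges :=
  rewrite /grid_degree /=;
  repeat match goal with |- context [m ?d ?a ?b] =>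
    rewrite (@m_out d a b); last by rewrite /edge_at; lia end.

(* [y] is the row shared with the central hexagons, [z] the outer row, and [w]
   the lower of the two. *)
Local Lemma m_half i (t : bool) : i < n ->
  let y := if t then 2 else 1 in
  let z := if t then 3 else 0 in
  let w := if t then 2 else 0 in
  let s := leg (word_of i) y in
  let c := mid (word_of i) in
  [/\ m false (4 * i).+2 z = ~~ s, m false (4 * i).+3 z = s, m true (4 * i).+4 w = ~~ s
   & [/\ m false (4 * i).+2 y = ~~ s && ~~ c, m false (4 * i).+3 y = s && ~~ c,
         m false (4 * i).+1 y = c && ~~ s & m false (4 * i).+4 y = c && s]].
Proof.
move=> lt_in y z w s c.
have sE : s = m true (4 * i).+2 w by rewrite /s /w /y; case: (t).
rewrite {}/c sE /mid /=.
apply: half_block; rewrite {sE}/s {}/w {}/y {}/z; case: t.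
- by degree_at (4 * i).+3 3; drop_nonedges; lia.
- by degree_at (4 * i).+3 0; drop_nonedges; lia.
- by degree_at (4 * i).+2 3; drop_nonedges; lia.
- by degree_at (4 * i).+2 0; drop_nonedges; lia.
- by degree_at (4 * i).+4 3; drop_nonedges; lia.
- by degree_at (4 * i).+4 0; drop_nonedges; lia.
- by degree_at (4 * i).+2 2; drop_nonedges; lia.
- by degree_at (4 * i).+2 1; drop_nonedges; lia.
- by degree_at (4 * i).+3 2; drop_nonedges; lia.
- by degree_at (4 * i).+3 1; drop_nonedges; lia.
- by degree_at (4 * i).+4 2; drop_nonedges; lia.
- by degree_at (4 * i).+4 1; drop_nonedges; lia.
Qed.

Local Lemma m_column i (t : bool) : i <= n ->
  let y := if t then 2 else 1 in
  m false (4 * i).+1 y + m true (4 * i).+1 1 + m false (4 * i) y = 1.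
Proof.
move=> le_in; rewrite /=; case: t.
  by degree_at (4 * i).+1 2; drop_nonedges; lia.
by degree_at (4 * i).+1 1; drop_nonedges; lia.
Qed.

(* Left to right, the two row edges crossing a cut are both matched or both
   unmatched, which excludes central edges with differing legs. *)
Local Lemma word_of_good i : good (word_of i).
Proof.
have [lt_in|le_ni] := ltnP i n; last first.
  by rewrite /good /mid /= m_out // /edge_at; lia.
have [k lt_ki] := ubnP i; elim: k => // k IHk in i lt_in lt_ki *.
have [b0 b1 b2 [b3 b4 bL bR]] := m_half false lt_in.
have [t0 t1 t2 [t3 t4 tL tR]] := m_half true lt_in.
have := m_column false (ltnW lt_in); have := m_column true (ltnW lt_in).
rewrite /= tL bL.
have -> : m false (4 * i) 2 = m false (4 * i) 1.
  case: i lt_in lt_ki {b0 b1 b2 b3 b4 bL bR t0 t1 t2 t3 t4 tL tR} => [|i] lt_in lt_ki.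
    by rewrite !m_out // /edge_at; lia.
  rewrite mulnS.
  have [_ _ _ [_ _ _ ->]] := m_half false (ltnW lt_in).
  have [_ _ _ [_ _ _ ->]] := m_half true (ltnW lt_in).
  have := IHk i (ltnW lt_in) lt_ki; rewrite /good /leg /=.
  by case: (mid _) => //= /eqP ->.
rewrite /good /leg /=; case: (mid _) => //=.
by do 4 case: (m _ _ _).
Qed.

Lemma word_of_valid : valid_word n word_of.
Proof.
have outE i : n <= i -> mid (word_of i) = false.
  by move=> le_ni; rewrite /mid /= m_out // /edge_at; lia.
split=> [i|i|i /outE->] //; first exact: word_of_good.
move=> Bi; have [|le_ni] := ltnP i.+1 n; last first.
  by rewrite /isA outE.
move=> lt_in; have := m_column true (ltnW lt_in); rewrite /= mulnS.
have [_ _ _ [_ _ _ ->]] := m_half true (ltnW lt_in).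
rewrite -mulnS; have [_ _ _ [_ _ -> _]] := m_half true lt_in.
by move: Bi; rewrite /isA /isB /leg /mid /=; do 5 case: (m _ _ _).
Qed.

Local Lemma m_columnE i : i <= n -> m true (4 * i).+1 1 = column word_of i.
Proof.
move=> le_in; have := m_column true le_in; rewrite /=.
have -> : m false (4 * i).+1 2 = isA (word_of i).
  move: le_in; rewrite leq_eqVlt => /predU1P[->|lt_in].
    by rewrite /isA (negPf (valid_end word_of_valid _)) // m_out // /edge_at; lia.
  by have [_ _ _ [_ _ -> _]] := m_half true lt_in.
have -> : m false (4 * i) 2 = (0 < i) && isB (word_of i.-1).
  case: i le_in => [|i] lt_in; first by rewrite m_out.
  by rewrite mulnS; have [_ _ _ [_ _ _ ->]] := m_half true lt_in.
by rewrite /column; case: (isA _); case: (_ && _); case: (m _ _ _).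
Qed.

Lemma word_of_edge d x y : m d x y = edge_at n d x y && word_edge word_of d x y.
Proof.
have [Exy|/m_out //] := boolP (edge_at n d x y); rewrite /=.
have [|i [r [Dx r_lt4]]] := @block_split x.
  by move: Exy; rewrite /edge_at; case: d; lia.
have [lt_in|le_ni] := ltnP i n; last first.
  have [Di Dd Dr Dy] : [/\ i = n, d = true, r = 0 & y = 1].
    by move: Exy; rewrite /edge_at; case: d; split; lia.
  by rewrite Dx Dd Dr Dy addn0 word_edgeE m_columnE // Di.
have [b0 b1 b2 [b3 b4 bL bR]] := m_half false lt_in.
have [t0 t1 t2 [t3 t4 tL tR]] := m_half true lt_in.
have colE := m_columnE (ltnW lt_in).
move: Exy; rewrite Dx; case: r {Dx} r_lt4 => [|[|[|[|]]]] // _;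
  rewrite ?addn0 ?addn1 ?addn2 ?addn3 word_edgeE edge_atE //; case: d => /=;
  by case: y => [|[|[|[|]]]] //=; rewrite ?andbT.
Qed.
End Classification.

Lemma good_leg l y : good l -> mid l -> leg l y = l.2.
Proof. by rewrite /good /leg => /implyP gl /gl/eqP ->; case: ifP. Qed.

Lemma word_edge_degree n u x y : 0 < n -> valid_word n u -> vertex_at n x y ->
  grid_degree (fun d x y => edge_at n d x y && word_edge u d x y) x y = 1.
Proof.
move=> n_gt0 [u_good u_next u_end] Vxy.
have [|i [r [Dx r_lt4]]] := @block_split x.
  by move: Vxy; rewrite /vertex_at; lia.
have lt_y : y < 4 by move: Vxy; rewrite /vertex_at; lia.
rewrite /grid_degree; have [r0|r_gt0] := posnP r.
  have le_in : i <= n by move: Vxy; rewrite /vertex_at; lia.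
  have y12 : (y == 1) || (y == 2) by move: Vxy; rewrite /vertex_at; lia.
  rewrite {}Dx {}r0 addn0 /=.
  have -> : edge_at n false (4 * i).+1 y && word_edge u false (4 * i).+1 y = isA (u i).
    rewrite word_edgeE /isA; have [lt_in|le_ni] := ltnP i n.
      by rewrite edge_atE // y12 /=; case: mid (@good_leg _ y (u_good i)) => // ->.
    by rewrite (negPf (u_end _ le_ni)) andbF.
  have -> : edge_at n false (4 * i) y && word_edge u false (4 * i) y
            = (0 < i) && isB (u i.-1).
    case: i le_in {Vxy} => [|i] lt_in; first by rewrite /edge_at /=; lia.
    rewrite mulnS word_edgeE edge_atE //= y12 /isB /=.
    by case: mid (@good_leg _ y (u_good i)) => // ->.
  have colE z : edge_at n true (4 * i).+1 z && word_edge u true (4 * i).+1 z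
                = (z == 1) && column u i.
    by rewrite word_edgeE; congr andb; rewrite /edge_at; lia.
  have : ~~ (isA (u i) && ((0 < i) && isB (u i.-1))).
    by case: i {Vxy le_in colE} => [|i]; rewrite ?andbF //=;
      apply/negP => /andP[Ai /u_next]; rewrite Ai.
  by rewrite !colE /column; case/orP: y12 => /eqP->; case: (isA _); case: (_ && isB _).
have lt_in : i < n by move: Vxy; rewrite /vertex_at; lia.
rewrite Dx in Vxy *; case: r {Dx} r_lt4 r_gt0 Vxy => [|[|[|[|]]]] // _ _ Vxy;
 rewrite ?addn1 ?addn2 ?addn3 !word_edgeE !edge_atE //=;
 by case: y lt_y {Vxy} => [|[|[|[|]]]] // _; rewrite /leg; case: (u i) => [[[] []] []].
Qed.

Definition word_set n (u : nat -> letter) : {set E n} :=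
  [set e in EH n |
    word_edge u ((coord e.1).1 == (coord e.2).1) (coord e.1).1 (coord e.1).2].

Lemma mem_word_set n u (e : E n) d x y : 0 < n -> ecoord e = key d x y ->
  (e \in word_set n u) = edge_at n d x y && word_edge u d x y.
Proof.
move=> n_gt0 De; rewrite in_set.
have [-> ->] : coord e.1 = (key d x y).1 /\ coord e.2 = (key d x y).2 by rewrite -De.
have -> : ((key d x y).1.1 == (key d x y).2.1) = d.
  by rewrite /key; case: (d); rewrite /= ?eqxx //; lia.
congr andb; apply/(mem_EH e n_gt0)/idP => [[d' [x' [y']]]|Exy]; last by exists d, x, y.
by rewrite De => -[/eqP]; rewrite key_eq => /and3P[/eqP-> /eqP-> /eqP->].
Qed.

Lemma has_edge_word n u d x y : 0 < n ->
  has_edge (word_set n u) d x y = edge_at n d x y && word_edge u d x y.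
Proof.
move=> n_gt0; apply/exists_inP/idP => [[e eu /eqP De]|/[dup] Exy /andP[Ed _]].
  by rewrite -(mem_word_set u n_gt0 De).
have [e De] := ecoord_surj Ed; exists e; last exact/eqP.
by rewrite (mem_word_set u n_gt0 De).
Qed.

Lemma word_set_sub n u : word_set n u \subset EH n.
Proof. by apply/subsetP => e; rewrite inE => /andP[]. Qed.

Lemma word_set_pm n u : 0 < n -> valid_word n u -> is_pm (VH n) (EH n) (word_set n u).
Proof.
move=> n_gt0 u_valid; apply/is_pmP => //; split=> [|x y Vxy]; first exact: word_set_sub.
rewrite -(word_edge_degree n_gt0 u_valid Vxy).
by rewrite /grid_degree !has_edge_word.
Qed.

Lemma pm_word_set n M : 0 < n -> is_pm (VH n) (EH n) M ->
  valid_word n (word_of (has_edge M)) /\ M = word_set n (word_of (has_edge M)).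
Proof.
move=> n_gt0 /is_pmP-/(_ n_gt0)[sME degM].
have M_edge := fun d x y => @has_edge_sub n M d x y n_gt0 sME.
split; first exact: word_of_valid.
apply: has_edge_inj => //; first exact: word_set_sub.
by move=> d x y Exy; rewrite has_edge_word // -word_of_edge.
Qed.

Lemma word_of_word_set n u i : i < n ->
  word_of (has_edge (word_set n u)) i = u i.
Proof.
move=> lt_in; rewrite /word_of !has_edge_word ?(leq_trans _ lt_in) //.
by rewrite !edge_atE // !word_edgeE /leg /mid /=; case: (u i) => [[]].
Qed.

Lemma eq_word_set n u v : 0 < n -> valid_word n u -> valid_word n v ->
  {in gtn n, u =1 v} -> word_set n u = word_set n v.
Proof.
move=> n_gt0 u_valid v_valid eq_uv.
have colE i : i <= n -> column u i = column v i.
  move=> le_in; rewrite /column; congr (~~ _ && ~~ _).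
    move: le_in; rewrite leq_eqVlt => /predU1P[->|lt_in]; last by rewrite eq_uv.
    by rewrite /isA (negPf (valid_end u_valid _)) // (negPf (valid_end v_valid _)).
  by case: i le_in => //= i lt_in; rewrite eq_uv.
apply: has_edge_inj; rewrite ?word_set_sub // => d x y Exy.
rewrite !has_edge_word //; congr andb.
have [x_gt0 le_xn] : 0 < x /\ x <= (4 * n).+1.
  by move: Exy; rewrite /edge_at; case: d; lia.
have [i [r [Dx r_lt4]]] := block_split x_gt0.
have le_in : i <= n by lia.
rewrite {}Dx in Exy le_xn *; case: r r_lt4 Exy le_xn => [|[|[|[|]]]] // _;
  rewrite ?addn0 ?addn1 ?addn2 ?addn3 !word_edgeE => Exy le_xn.
- case: d Exy => Exy; first exact: colE.
  by rewrite eq_uv // inE; move: Exy; rewrite /edge_at; lia.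
- by rewrite eq_uv // inE; lia.
- by rewrite eq_uv // inE; lia.
- by rewrite eq_uv // inE; lia.
Qed.

Lemma is_pm_setD (T : finType) (VS : {set T}) (ES S M : {set T * T}) :
  is_pm VS (ES :\: S) M = is_pm VS ES M && [disjoint M & S].
Proof. by rewrite /is_pm subsetD andbAC. Qed.

Lemma anti_forcing_wordP n u (S : {set E n}) : 0 < n -> valid_word n u ->
  reflect (S \subset EH n :\: word_set n u /\
     forall v, valid_word n v -> [disjoint word_set n v & S] -> {in gtn n, u =1 v})
   (anti_forcing (VH n) (EH n) (word_set n u) S).
Proof.
move=> n_gt0 u_valid; apply: (iffP andP) => -[sS uniqM]; split=> //.
  move=> v v_valid dis_vS i lt_in.
  have := forallP uniqM (word_set n v).
  rewrite is_pm_setD word_set_pm // dis_vS => /eqP Ev.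
  by rewrite -(word_of_word_set u lt_in) -Ev word_of_word_set.
apply/forallP=> M; apply/implyP; rewrite is_pm_setD => /andP[pmM dis_MS].
have [v_valid DM] := pm_word_set n_gt0 pmM.
apply/eqP; rewrite DM in dis_MS *.
by apply/esym/eq_word_set => //; apply: uniqM.
Qed.

(** * Upper bound for the anti-forcing number *)

Definition weight (l : letter) : nat :=
  if mid l then 1 else if l.1.2 == l.2 then 3 else 2.

(* One slot per unit of cost. *)
Definition slots n (u : nat -> letter) : seq (nat * nat) :=
  [seq (i, c) | i <- iota 0 n, c <- iota 0 (weight (u i))].

Lemma mem_slots n u i c : ((i, c) \in slots n u) = (i < n) && (c < weight (u i)).
Proof.
apply/allpairsPdep/andP => [[j [k [jn kc [-> ->]]]]|[lt_in lt_c]].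
  by rewrite !mem_iota in jn kc.
by exists i, c; rewrite !mem_iota.
Qed.

Lemma slots_uniq n u : uniq (slots n u).
Proof.
apply: allpairs_uniq_dep => [|i _|[i c] [j k] _ _ [-> ->] //]; exact: iota_uniq.
Qed.

Lemma size_slots n u : size (slots n u) = \sum_(i < n) weight (u i).
Proof.
rewrite size_allpairs_dep sumnE big_map -(big_mkord xpredT (fun i => weight (u i))).
by rewrite /index_iota subn0; apply: eq_bigr => i _; rewrite size_iota.
Qed.

Definition blocker (u : nat -> letter) (p : nat * nat) : bool * nat * nat :=
  let: (i, c) := p in let l := u i in
  if mid l then (true, (4 * (i + l.2)).+1, 1) else
  match c with
  | 0 => (false, (if l.1.2 then (4 * i).+2 else (4 * i).+3), 0)
  | 1 => (false, (if l.2 then (4 * i).+2 else (4 * i).+3), 3)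
  | _ => (false, (if l.2 then (4 * i).+4 else (4 * i).+1), 2)
  end.

Lemma blocker_edge n u p : valid_word n u -> p \in slots n u ->
  let: (d, x, y) := blocker u p in edge_at n d x y && ~~ word_edge u d x y.
Proof.
move=> u_valid; case: p => i c; rewrite mem_slots => /andP[lt_in].
rewrite /blocker /weight; have [mid_i _|nmid_i] := ifP.
  rewrite word_edgeE /column; have [top_i|ntop_i] := boolP (u i).2.
    by rewrite addn1 /= /isB mid_i top_i andbF andbT /edge_at; lia.
  by rewrite addn0 /isA mid_i ntop_i /= andbT /edge_at; lia.
case: c => [|[|c]] _; case: ifP => si;
  by rewrite edge_atE // word_edgeE /leg nmid_i /= ?si.
Qed.

Lemma blocker_forces n u v : valid_word n u -> valid_word n v ->
  {in slots n u, forall p, let: (d, x, y) := blocker u p in ~~ word_edge v d x y} ->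
  {in gtn n, u =1 v}.
Proof.
move=> u_valid v_valid avoid.
have slotI i c : i < n -> c < weight (u i) -> _ :=
  fun lt_in lt_c =>
    avoid (i, c) (etrans (mem_slots n u i c) (introT andP (conj lt_in lt_c))).
have eqN i : i < n -> ~~ mid (u i) -> v i = u i.
  move=> lt_in nmid.
  have := valid_good v_valid i; have := slotI i 2 lt_in.
  have := slotI i 1 lt_in; have := slotI i 0 lt_in.
  rewrite /blocker /weight (negPf nmid).
  have -> : (0 < if (u i).1.2 == (u i).2 then 3 else 2) by case: ifP.
  have -> : (1 < if (u i).1.2 == (u i).2 then 3 else 2) by case: ifP.
  move=> /(_ isT) h0 /(_ isT) h1.
  have Eb : (v i).1.2 = (u i).1.2.
    by move: h0; case: ifP => _; rewrite word_edgeE /leg /= ?andbT; case: (_.1.2).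
  have Et : (v i).2 = (u i).2.
    by move: h1; case: ifP => _; rewrite word_edgeE /leg /= ?andbT; case: (_.2).
  have [_ /(_ isT) h2|neq _] := eqVneq (u i).1.2.
    suff: mid (v i) = mid (u i).
      by rewrite /mid; case: (v i) (u i) Eb Et => [[? ?] ?] [[? ?] ?] /= -> -> ->.
    move: h2; rewrite -Et; case: ifP => st;
      by rewrite word_edgeE /leg /= st ?andbT (negPf nmid); case: mid.
  rewrite /good Eb Et (negPf neq) implybF => nmid_v.
  move: nmid; rewrite /mid in nmid_v *.
  by case: (v i) (u i) Eb Et nmid_v => [[? ?] ?] [[? ?] ?] /= -> -> /negPf-> /negPf->.
have eqM i : mid (v i) -> mid (u i) -> (v i).2 = (u i).2 -> v i = u i.
  have := valid_good v_valid i; have := valid_good u_valid i; rewrite /good /mid.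
  by case: (v i) (u i) => [[[] []] []] [[[] []] []].
have eqA i : i < n -> isA (u i) -> v i = u i.
  elim: i => [|i IHi] lt_in /[dup] Ai /andP[mid_i /negPf ntop_i].
    have := slotI 0 0 lt_in;
        rewrite /blocker /weight mid_i ntop_i word_edgeE /column andbT negbK.
    by case/(_ isT)/andP => mv /negPf tv; apply: eqM => //; rewrite tv ntop_i.
  have := slotI i.+1 0 lt_in;
    rewrite /blocker /weight mid_i ntop_i addn0 word_edgeE /column /=.
  have -> : v i = u i.
    have [mi|] := boolP (mid (u i)); last exact/eqN/ltnW.
    apply: IHi (ltnW lt_in) _; rewrite /isA mi /=.
    by apply: contraL Ai => ti; apply: (valid_next u_valid); rewrite /isB mi ti.
  have -> /= : isB (u i) = false by apply: contraTF Ai => /(valid_next u_valid).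
  rewrite andbT negbK.
  by case/(_ isT)/andP => mv /negPf tv; apply: eqM => //; rewrite tv ntop_i.
have eqB i : i < n -> isB (u i) -> v i = u i.
  have [k] := ubnP (n - i); elim: k => // k IHk in i *.
  move=> lt_k lt_in /[dup] Bi /andP[mid_i top_i].
  have := slotI i 0 lt_in;
    rewrite /blocker /weight mid_i top_i addn1 word_edgeE /column /=.
  have nA := valid_next u_valid Bi.
  have -> /= : isA (v i.+1) = false.
    have [lt_i1|le_ni] := ltnP i.+1 n; last first.
      by rewrite /isA (negPf (valid_end v_valid le_ni)).
    have [mi|nm] := boolP (mid (u i.+1)); last by rewrite eqN // (negPf nA).
    rewrite IHk ?(negPf nA) //; first by lia.
    by move: nA; rewrite /isA /isB mi /= negbK.
  rewrite negbK.
  by case/(_ isT)/andP => mv tv; apply: eqM => //; rewrite tv top_i.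
move=> i lt_in; apply/esym; have [mi|/eqN-> //] := boolP (mid (u i)).
have [ti|ti] := boolP (u i).2; [apply: eqB | apply: eqA] => //.
  by rewrite /isB mi ti.
by rewrite /isA mi ti.
Qed.

(** * Lower bound for the anti-forcing number *)

Fixpoint startA (u : nat -> letter) (i : nat) : nat :=
  if isA (u i) then (if i is j.+1 then startA u j else 0) else i.

Fixpoint endB_fuel (u : nat -> letter) (k i : nat) : nat :=
  if k is k'.+1 then (if isB (u i) then endB_fuel u k' i.+1 else i) else i.

Definition endB n u i := endB_fuel u (n - i) i.

Lemma startA_id u i : ~~ isA (u i) -> startA u i = i.
Proof. by case: i => [|i] /= /negPf->. Qed.

Lemma startA_S u i : isA (u i.+1) -> startA u i.+1 = startA u i.
Proof. by move=> /= ->. Qed.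

Lemma endB_id n u i : ~~ isB (u i) -> endB n u i = i.
Proof. by rewrite /endB; case: (n - i) => //= k /negPf->. Qed.

Lemma endB_S n u i : valid_word n u -> isB (u i) -> endB n u i = endB n u i.+1.
Proof.
move=> u_valid Bi; have lt_in : i < n.
  rewrite ltnNge; apply/negP => /(valid_end u_valid)/negPf.
  by case/andP: Bi => ->.
by rewrite /endB subnS; case: (n - i) (subn_gt0 i n) => [|k _ /=]; rewrite ?lt_in // Bi.
Qed.

Definition flip n (u : nat -> letter) (p : nat * nat) : nat -> letter :=
  let: (i, c) := p in let: (m, b, t) := u i in
  if m then fun j => if j == i then (false, b, t) else u j else
  match c with
  | 0 => fun j => if j == i then (false, ~~ b, t) else u j
  | 1 => fun j => if j == i then (false, b, ~~ t) else u j
  | _ => if t then fun j => if startA u j == i then (true, true, true) else u j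
         else fun j => if endB n u j == i then (true, false, false) else u j
  end.

(* The slot charged for an edge.  Inside a run A^k or B^k, the edges other than
   the inner row edges are charged to the end of the run, because the flip of an
   N letter adjacent to the run changes the whole run. *)
Definition letter_owner (l : letter) (i a b : nat) (d : bool) (r y : nat) : nat * nat :=
  if mid l then
    if ~~ d && ((y == 1) || (y == 2)) && ((r == 1) || (r == 2)) then (i, 0)
    else (if l.2 then b else a, 2)
  else if (if d then r == 2 else (r == 0) || (r == 3)) then (i, 2)
  else (i, (1 < y) : nat).

Definition owner n (u : nat -> letter) (d : bool) (x y : nat) : nat * nat :=
  let i := x.-1 %/ 4 in let r := x.-1 %% 4 in
  if d && (r == 0) then (if isA (u i) then (i, 0) else (i.-1, 0))
  else letter_owner (u i) i (startA u i) (endB n u i) d r y.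

Definition flip_spec n u p v :=
  [/\ valid_word n v, v p.1 != u p.1,
     (forall i d r y, r < 4 -> ~~ (d && (r == 0)) -> letter_edge (v i) d r y ->
        ~~ letter_edge (u i) d r y ->
        letter_owner (u i) i (startA u i) (endB n u i) d r y = p) &
     (forall i, column v i -> ~~ column u i ->
        (if isA (u i) then (i, 0) else (i.-1, 0)) = p)].

Lemma columnN u i : ~~ column u i = isA (u i) || (0 < i) && isB (u i.-1).
Proof. by rewrite negb_and !negbK. Qed.

Lemma update_spec n u i c l' : valid_word n u -> i < n ->
  good l' -> l' != u i -> ~~ mid l' ->
  (forall d r y, r < 4 -> ~~ (d && (r == 0)) -> letter_edge l' d r y ->
     ~~ letter_edge (u i) d r y ->
     letter_owner (u i) i (startA u i) (endB n u i) d r y = (i, c)) ->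
  (mid (u i) -> c = 0) ->
  flip_spec n u (i, c) (fun j => if j == i then l' else u j).
Proof.
move=> u_valid lt_in good_l' neq_l' /negPf nmid_l' owner_l' c0.
have isA' : isA l' = false by rewrite /isA nmid_l'.
have isB' : isB l' = false by rewrite /isB nmid_l'.
split=> /=; rewrite ?eqxx //.
- split=> j; first by case: eqP => // _; apply: (valid_good u_valid).
    case: eqP; rewrite ?isB' // => _ /(valid_next u_valid).
    by case: eqP; rewrite ?isA'.
  by case: eqP => [->|_ /(valid_end u_valid)//]; rewrite nmid_l'.
- move=> j d r y r_lt4 ncol; case: eqP => [->|_ -> //]; exact: owner_l'.
move=> j; rewrite columnN /column => /andP[nA nB] /orP[Aj|/andP[j_gt0 Bj]].
  move: nA; rewrite Aj; case: eqP => [ji|]; last by rewrite Aj.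
  by move: Aj; rewrite ji => /andP[/c0-> _].
move: nB; rewrite j_gt0 /=; case: eqP => [ji|]; last by rewrite Bj.
have := valid_next u_valid Bj; rewrite prednK // => /negPf->.
by move: Bj; rewrite ji => /andP[/c0-> _].
Qed.

Lemma flipP n u p : valid_word n u -> p \in slots n u -> flip_spec n u p (flip n u p).
Proof.
move=> u_valid; case: p => i c; rewrite mem_slots => /andP[lt_in].
rewrite /flip /weight; case Du: (u i) => [[m b] t]; rewrite /mid /=.
have := valid_good u_valid i; rewrite Du /good /mid /=.
case: m Du => /= [Du /eqP Db | Du _].
  rewrite ltnS leqn0 => /eqP->.
  apply: update_spec; rewrite ?Du ?xpair_eqE //.
  move=> d r y; subst b; case: t {Du}; case: d; case: r => [|[|[|[|]]]] // _ _;
    by case: y => [|[|[|y]]].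
case: c => [|[|c]].
- move=> _; apply: update_spec; rewrite ?Du ?xpair_eqE ?andbF //=;
    first by case: b {Du}; case: t.
  move=> d r y; case: b {Du}; case: t; case: d; case: r => [|[|[|[|]]]] // _ _;
    by case: y => [|[|[|y]]].
- move=> _; apply: update_spec; rewrite ?Du ?xpair_eqE ?andbF //=;
    first by case: b {Du}; case: t.
  move=> d r y; case: b {Du}; case: t; case: d; case: r => [|[|[|[|]]]] // _ _;
    by case: y => [|[|[|y]]].
case: eqP => // Db; case: c => // _; subst b.
case: t Du => Du.
  have st_i : startA u i = i by rewrite startA_id // Du.
  have stP j : startA u j = i -> j = i \/ isA (u j).
    by have [|/startA_id->] := boolP (isA (u j)); [right | left].
  have nextA j : isA (u j.+1) -> startA u j.+1 = startA u j := @startA_S u j.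
  split=> /=.
  - split=> j; first by case: ifP => // _; apply: (valid_good u_valid).
      have [Aj|nAj] := boolP (isA (u j.+1)); last first.
        by move=> _; case: ifP.
      rewrite nextA //; case: ifP => // _ /(valid_next u_valid).
      by rewrite Aj.
    move=> le_nj; have nmid := valid_end u_valid le_nj.
    rewrite startA_id; last by rewrite /isA (negPf nmid).
    by case: eqP => // ji; lia.
  - by rewrite st_i eqxx Du.
  - move=> j d r y r_lt4 ncol; case: eqP => [st_j|_ -> //].
    case: (stP j st_j) => [->|].
      rewrite Du; case: d ncol; case: r r_lt4 => [|[|[|[|]]]] // _ _;
        by case: y => [|[|[|y]]].
    move=> /andP[mj tj]; have := valid_good u_valid j; rewrite /good mj /=.
    move: mj tj; rewrite /mid st_j; case: (u j) => [[mu bu] tu] /= -> /negPf-> /eqP->.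
    by case: d ncol; case: r r_lt4 => [|[|[|[|]]]] // _ _; case: y => [|[|[|y]]].
  move=> j; rewrite columnN /column => /andP[nA nB] /orP[Aj|/andP[j_gt0 Bj]].
    exfalso; case: j Aj nA nB => [|j] Aj.
      rewrite /= Aj; case: eqP => [i0|_]; last by rewrite Aj.
      by move: Aj; rewrite i0 Du.
    rewrite nextA //; case: ifP => [_ _ //|]; by rewrite Aj.
  by move: nB; rewrite j_gt0 /=; case: ifP; rewrite ?Bj.
have en_i : endB n u i = i by rewrite endB_id // Du.
have enP j : endB n u j = i -> j = i \/ isB (u j).
  by have [|/(endB_id n)->] := boolP (isB (u j)); [right | left].
have nextB j : isB (u j) -> endB n u j = endB n u j.+1 := @endB_S n u j u_valid.
split=> /=.
- split=> j; first by case: ifP => // _; apply: (valid_good u_valid).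
    case: ifP => // nR Bj; move: nR; rewrite nextB // => ->.
    exact: (valid_next u_valid).
  move=> le_nj; have nmid := valid_end u_valid le_nj.
  rewrite endB_id; last by rewrite /isB (negPf nmid).
  by case: eqP => // ji; lia.
- by rewrite en_i eqxx Du.
- move=> j d r y r_lt4 ncol; case: eqP => [en_j|_ -> //].
  case: (enP j en_j) => [->|].
    rewrite Du; case: d ncol; case: r r_lt4 => [|[|[|[|]]]] // _ _;
      by case: y => [|[|[|y]]].
  move=> /andP[mj tj]; have := valid_good u_valid j; rewrite /good mj /=.
  move: mj tj; rewrite /mid en_j; case: (u j) => [[mu bu] tu] /= -> -> /eqP->.
  by case: d ncol; case: r r_lt4 => [|[|[|[|]]]] // _ _; case: y => [|[|[|y]]].
move=> j; rewrite columnN /column => /andP[nA nB] /orP[Aj|/andP[j_gt0 Bj]].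
  by move: nA; case: ifP; rewrite ?Aj.
exfalso; case: j j_gt0 Bj nA nB => // j _ /= Bj.
by rewrite -nextB //; case: ifP => //= _ _; rewrite Bj.
Qed.

Lemma owner_flip n u p d x y : valid_word n u -> p \in slots n u -> 0 < x ->
  word_edge (flip n u p) d x y -> ~~ word_edge u d x y -> owner n u d x y = p.
Proof.
move=> u_valid /(flipP u_valid)[_ _ own_l own_c] /block_split[i [r [-> r_lt4]]].
rewrite !word_edge_block // /owner.
have [-> ->] : (4 * i + r).+1.-1 %/ 4 = i /\ (4 * i + r).+1.-1 %% 4 = r by lia.
by case: ifP => col; [apply: own_c | apply: own_l => //; rewrite col].
Qed.

Lemma anti_forcing_size n u (S : {set E n}) : 0 < n -> valid_word n u ->
  anti_forcing (VH n) (EH n) (word_set n u) S -> \sum_(i < n) weight (u i) <= #|S|.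
Proof.
move=> n_gt0 u_valid /(anti_forcing_wordP _ n_gt0 u_valid)[sS uniqM].
pose own (e : E n) :=
  owner n u ((coord e.1).1 == (coord e.2).1) (coord e.1).1 (coord e.1).2.
rewrite -size_slots cardE -(size_map own).
apply: uniq_leq_size (slots_uniq n u) _ => p pu.
have [v_valid neq_vu _ _] := flipP u_valid pu.
have : ~~ [disjoint word_set n (flip n u p) & S].
  apply: contraL pu => /(uniqM _ v_valid) eq_uv; case: p neq_vu eq_uv {v_valid} => i c /=.
  rewrite mem_slots => neq_vu eq_uv.
  by apply: contra neq_vu => /andP[lt_in _]; rewrite -eq_uv.
case/pred0Pn => e /andP[/= ev eS]; apply/mapP; exists e; first by rewrite mem_enum.
have [eEH eNu] : e \in EH n /\ e \notin word_set n u.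
  by have := subsetP sS e eS; rewrite in_setD => /andP[].
have [d [x [y [De Exy]]]] := mem_EH e n_gt0 eEH.
have x_gt0 : 0 < x by move: Exy; rewrite /edge_at; case: d De; lia.
move: ev eNu; rewrite !(mem_word_set _ n_gt0 De) Exy /= => ev eNu.
rewrite /own.
have [-> ->] : coord e.1 = (key d x y).1 /\ coord e.2 = (key d x y).2 by rewrite -De.
have -> : ((key d x y).1.1 == (key d x y).2.1) = d.
  by rewrite /key; case: (d); rewrite /= ?eqxx //; lia.
by apply/esym/(owner_flip u_valid pu).
Qed.

Lemma anti_forcing_exists n u : 0 < n -> valid_word n u ->
  exists2 S : {set E n}, anti_forcing (VH n) (EH n) (word_set n u) S &
    #|S| <= \sum_(i < n) weight (u i).
Proof.
move=> n_gt0 u_valid.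
pose keys := [seq (let: (d, x, y) := blocker u p in key d x y) | p <- slots n u].
pose S := [set e : E n | ecoord e \in keys]; exists S; last first.
  have -> : \sum_(i < n) weight (u i) = size keys by rewrite size_map size_slots.
  rewrite cardE -(size_map (@ecoord n)).
  apply: uniq_leq_size; first by rewrite (map_inj_uniq (@ecoord_inj n)) enum_uniq.
  by move=> k /mapP[e eS ->]; move: eS; rewrite mem_enum inE.
apply/anti_forcing_wordP => //; split.
  apply/subsetP => e; rewrite inE => /mapP[p /(blocker_edge u_valid)].
  case: (blocker u p) => [[d x] y] /andP[Exy Nxy] De.
  rewrite in_setD (mem_word_set u n_gt0 De) Exy Nxy /=.
  by apply/mem_EH => //; exists d, x, y.
move=> v v_valid dis_vS; apply: blocker_forces => // p pu.
have := blocker_edge u_valid pu.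
case Dp: (blocker u p) => [[d x] y] /andP[Exy Nxy]; have [e De] := ecoord_surj Exy.
have /(_ e) := disjointFl dis_vS; rewrite (mem_word_set v n_gt0 De) Exy /= => -> //.
by rewrite inE De; apply/mapP; exists p; rewrite // Dp.
Qed.

Lemma af_word_set n u : 0 < n -> valid_word n u ->
  af (VH n) (EH n) (word_set n u) = \sum_(i < n) weight (u i).
Proof.
move=> n_gt0 u_valid; have [S afS leS] := anti_forcing_exists n_gt0 u_valid.
apply/eqP; rewrite eqn_leq; apply/andP; split.
  rewrite /af -Order.NatOrder.minEnat.
  exact: (Order.TotalTheory.bigmin_inf (T := nat) S _ _ _ afS leS).
apply: (big_ind (leq _)) => [|a b le_a le_b|T afT].
  exact: leq_trans (anti_forcing_size n_gt0 u_valid afS) (max_card _).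
  by rewrite leq_min le_a.
exact: anti_forcing_size.
Qed.

(** * Counting words *)

Definition letter0 : letter := (false, false, false).
Definition letterA : letter := (true, false, false).
Definition letterB : letter := (true, true, true).

Definition follows (l l' : letter) := isB l ==> ~~ isA l'.

Definition valid_seq (w : seq letter) := all good w && sorted follows w.

Lemma valid_seqP n (w : n.-tuple letter) :
  reflect (valid_word n (nth letter0 w)) (valid_seq w).
Proof.
apply: (iffP andP) => [[w_good w_next]|[w_good w_next w_end]].
  have out i : n <= i -> nth letter0 w i = letter0.
    by move=> le_ni; rewrite nth_default ?size_tuple.
  split=> i; last by move/out->.
    have [lt_in|/out-> //] := ltnP i n.
    by apply: (all_nthP letter0 w_good); rewrite size_tuple.
  have [lt_in|/out-> //] := ltnP i.+1 n.
  by apply/implyP; apply: (sortedP letter0 w_next); rewrite size_tuple.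
split; first by apply/(all_nthP letter0) => i _.
by apply/(sortedP letter0) => i _; apply/implyP/w_next.
Qed.

Lemma eq_valid_word n u v : {in gtn n, u =1 v} -> (forall i, n <= i -> ~~ mid (v i)) ->
  (forall i, n <= i -> good (v i)) -> valid_word n u -> valid_word n v.
Proof.
move=> eq_uv v_end v_good [u_good u_next u_end]; split=> // i.
  by have [lt_in|/v_good //] := ltnP i n; rewrite -eq_uv.
have [lt_in|/v_end/negPf nmid] := ltnP i.+1 n; last by rewrite [isA _]/isA nmid.
by rewrite -!eq_uv ?inE //; [apply: u_next | apply: ltnW].
Qed.

Local Open Scope ring_scope.

Definition word_poly n : {poly int} :=
  \sum_(w : n.-tuple letter | valid_seq w) 'X^(\sum_(l <- w) weight l).

Lemma Af_word_poly n : (0 < n)%N -> Af (VH n) (EH n) = word_poly n.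
Proof.
move=> n_gt0; rewrite /Af.
pose h (w : n.-tuple letter) := word_set n (nth letter0 w).
pose h' M := [tuple word_of (@has_edge n M) i | i < n].
have hK w : h' (h w) = w.
  by apply: eq_from_tnth => i; rewrite tnth_mktuple word_of_word_set // -tnth_nth.
have nth_h' M i : (i < n)%N -> nth letter0 (h' M) i = word_of (has_edge M) i.
  by move=> lt_in; rewrite -(tnth_nth _ _ (Ordinal lt_in)) tnth_mktuple.
have valid_h' M : is_pm (VH n) (EH n) M -> valid_word n (nth letter0 (h' M)).
  move=> /(pm_word_set n_gt0)[u_valid _]; apply: eq_valid_word u_valid => i.
  - by move=> lt_in; rewrite nth_h'.
  - by move=> le_ni; rewrite nth_default // size_tuple.
  - by move=> le_ni; rewrite nth_default // size_tuple.
rewrite (reindex_onto h h') /= => [|M pmM]; last first.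
  have [u_valid {2}->] := pm_word_set n_gt0 pmM.
  by apply: eq_word_set => //; [exact: valid_h' | move=> i; apply: nth_h'].
apply: eq_big => [w|w /andP[/valid_h' w_valid _]].
  rewrite hK eqxx andbT; apply/idP/valid_seqP => [/valid_h'|]; first by rewrite hK.
  exact: word_set_pm.
rewrite hK in w_valid.
rewrite af_word_set // big_tuple; congr ('X^_).
by apply: eq_bigr => i _; rewrite -tnth_nth.
Qed.

Lemma big_tuple_cons (V : nmodType) (T : finType) n (P : pred (n.+1.-tuple T))
    (F : n.+1.-tuple T -> V) :
  \sum_(w | P w) F w =
  \sum_l \sum_(w : n.-tuple T | P (cons_tuple l w)) F (cons_tuple l w).
Proof.
rewrite pair_big_dep /= (reindex (fun p : T * n.-tuple T => cons_tuple p.1 p.2)) //=.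
exists (fun w => (thead w, [tuple of behead w])) => [[l w]|w] _ /=.
  by congr pair; apply: val_inj.
by rewrite [RHS]tuple_eta; apply: val_inj.
Qed.

Lemma big_letter (V : nmodType) (F : letter -> V) :
  \sum_l F l = \sum_m \sum_b \sum_t F (m, b, t).
Proof. by rewrite pair_bigA /= pair_bigA /=; apply: eq_bigr => -[[]]. Qed.

Definition tail_poly n l : {poly int} :=
  \sum_(w : n.-tuple letter | all good w && path follows l w) 'X^(\sum_(l <- w) weight l).

Lemma word_polyS n : word_poly n.+1 = \sum_(l | good l) 'X^(weight l) * tail_poly n l.
Proof.
rewrite /word_poly big_tuple_cons [RHS]big_mkcond; apply: eq_bigr => l _.
rewrite /valid_seq /=; case: good => /=; last by rewrite big_pred0.
by rewrite big_distrr; apply: eq_bigr => w _; rewrite big_cons exprD.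
Qed.

Lemma tail_polyS n l :
  tail_poly n.+1 l = \sum_(l' | good l' && follows l l') 'X^(weight l') * tail_poly n l'.
Proof.
rewrite /tail_poly big_tuple_cons [RHS]big_mkcond; apply: eq_bigr => l' _ /=.
case: good => /=; last by rewrite big_pred0.
case: follows => /=; last by rewrite big_pred0 // => w; rewrite andbF.
by rewrite big_distrr; apply: eq_bigr => w _; rewrite big_cons exprD.
Qed.

Lemma tail_poly_free n l : ~~ isB l -> tail_poly n l = word_poly n.
Proof.
move=> /negPf nB; apply: eq_bigl => w; congr andb.
by case: (tval w) => //= l' s; rewrite /follows nB.
Qed.

Lemma word_poly0 : word_poly 0 = 1.
Proof.
rewrite /word_poly (big_pred1 [tuple]) => [|w]; first by rewrite big_nil.
by rewrite [w]tuple0; apply/esym/eqP.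
Qed.

Lemma tail_poly0 l : tail_poly 0 l = 1.
Proof.
rewrite /tail_poly (big_pred1 [tuple]) => [|w]; first by rewrite big_nil.
by rewrite [w]tuple0; apply/esym/eqP.
Qed.

Lemma word_poly_rec n :
  word_poly n.+1 =
  (2%:R * 'X^3 + 2%:R * 'X^2 + 'X) * word_poly n + 'X * tail_poly n letterB.
Proof.
rewrite word_polyS big_mkcond big_letter !big_bool /=.
rewrite !(@tail_poly_free n (_, _, false)) //.
rewrite !(@tail_poly_free n (false, _, _)) // /weight /good /mid /=.
rewrite expr1; ring.
Qed.

Lemma tail_poly_rec n : tail_poly n.+1 letterB = word_poly n.+1 - 'X * word_poly n.
Proof.
rewrite tail_polyS word_polyS (bigD1 (P := good) letterA) //=.
rewrite tail_poly_free // addrC addrK.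
by apply: eq_bigl => -[[[] []] []].
Qed.

Theorem theorem4p1 :
  AfH 1 = 2%:R * 'X^3 + 2%:R * 'X^2 + 2%:R * 'X /\
  (forall n : nat, (2 <= n)%N ->
     AfH n = (2%:R * 'X^3 + 2%:R * 'X^2 + 2%:R * 'X) * AfH n.-1 - 'X^2 * AfH n.-2).
Proof.
have AfHE n : AfH n = word_poly n.
  by case: n => [|n]; [rewrite word_poly0 | apply: Af_word_poly].
split=> [|[|[|n]] // _]; rewrite !AfHE.
  by rewrite word_poly_rec word_poly0 tail_poly0; ring.
by rewrite [LHS]word_poly_rec tail_poly_rec /=; ring.
Qed.
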